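(* Let $X$ be a real normed vector space, $L$ a nonempty set of functions $X\to\mathbb{R}$, and $f,\phi:X\to\mathbb{R}$ two $L$-convex functions. Let $(c_k)_{k\ge0}$ be a sequence of positive real numbers. Assume: (A1) for every $y\in X$ and every $\lambda\in\partial_L\phi(y)$, the sublevel sets $\{x\in X: D_\phi^\lambda(x,y)\le c\}$, $c\in\mathbb{R}$, are bounded; (A2) one of the following two conditions is satisfied: (a) $L-L\subset L$ and $c_k=1$ for all $k\ge0$; or (b) $L$ is a linear space and $\sum_{k=1}^\infty c_k=\infty$. Let $(x_k)_{k\in\mathbb{N}}$ be an infinite sequence of iterates produced by the abstract Bregman proximal point algorithm (described in the context), and assume that the sum rule applies at every iteration (in the sense defined in the context). Then $$\lim_{l\to\infty}f(x_l)=\inf_{x\in X}f(x).$$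
   Context: Let $X$ be a real normed vector space and $L$ a set of functions $X\to\mathbb{R}$. $L$-convexity: $f:X\to\mathbb{R}$ is $L$-convex if there is $U\subseteq L$ with $f(x)=\sup_{u\in U}u(x)$ for every $x\in X$. $L$-subdifferential: $\partial_L f(x)=\{l\in L:\ f(y)\ge f(x)+l(y)-l(x)\ \text{for all } y\in X\}$. Abstract Bregman divergence: for an $L$-convex $\phi:X\to\mathbb{R}$, $x,y\in X$ and $\lambda\in\partial_L\phi(y)$, $D_\phi^{\lambda}(x,y)=\phi(x)-\phi(y)-(\lambda(x)-\lambda(y))$. Sums and differences of sets of functions are elementwise, e.g. $L-L=\{l-l': l,l'\in L\}$. Abstract Bregman proximal point algorithm: choose $x_0\in X$ and $\lambda_0\in\partial_L\phi(x_0)$. For $k=0,1,2,\dots$: pick $x_{k+1}\in\operatorname{Argmin}_{x\in X}\{f(x)+\frac1{c_k}D_\phi^{\lambda_k}(x,x_k)\}$ (assumed nonempty); set $\lambda_{k+1}=\lambda_k-c_kg_{k+1}$, where $g_{k+1}\in\partial_L f(x_{k+1})$ is chosen so that $\lambda_{k+1}\in\partial_L\phi(x_{k+1})$ (such a choice exists when the sum rule applies); stop if $0\in\partial_L f(x_{k+1})$, otherwise continue. An infinite sequence of iterates is one for which the algorithm never stops. Sum rule: for a set $K$ of real functions on $X$ let $H_K=\{l+c: l\in K,\ c\in\mathbb{R}\}$, and for a set $H$ of real functions on $X$ and a function $h$ let $\operatorname{supp}(h,H)=\{u\in H: u(x)\le h(x)\ \text{for all } x\in X\}$. ''The sum rule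 applies at iteration $k$'' means that, with $f_1=f$, $L_1=L$, $f_2=\frac1{c_k}D_\phi^{\lambda_k}(\cdot,x_k)$ and $L_2=\{l-\lambda_k/c_k: l\in L\}$, one has $$\operatorname{supp}(f_1,H_{L_1})+\operatorname{supp}(f_2,H_{L_2})=\operatorname{supp}(f_1+f_2,\,H_{L_1}+H_{L_2}).$$ *)

(* Defs.v *)
From mathcomp Require Import all_boot all_order all_algebra.
From mathcomp Require Import all_classical all_reals all_analysis.

Set Implicit Arguments.
Unset Strict Implicit.
Unset Printing Implicit Defensive.

Import Order.TTheory GRing.Theory Num.Theory.
Import numFieldNormedType.Exports.

Local Open Scope classical_set_scope.
Local Open Scope ring_scope.

Section AbstractConvexity.
Context {R : realType} {X : normedModType R}.
Implicit Types (L K H : set (X -> R)) (f h phi lam : X -> R) (x y : X).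

Definition fset_add H K : set (X -> R) := [set u + v | u in H & v in K].

Definition fset_sub H K : set (X -> R) := [set u - v | u in H & v in K].

(* The supremum is taken in \bar R, so it is a genuine least upper bound and
   U = set0, whose supremum is -oo, cannot represent a real-valued f. *)
Definition L_convex L f : Prop :=
  exists2 U : set (X -> R), U `<=` L &
    forall x, (f x)%:E = ereal_sup [set (u x)%:E | u in U].

Definition L_subdiff L f x : set (X -> R) :=
  [set l | L l /\ forall y, f y >= f x + l y - l x].

(* bregman phi lam x y is the divergence D_phi^lam(x, y); it is only used for
   lam in the subdifferential of phi at y. *)
Definition bregman phi lam x y : R := phi x - phi y - (lam x - lam y).

Definition argmin h : set X := [set x | forall y, h x <= h y].

Definition const_shifts K : set (X -> R) :=
  [set (fun x => l x + c) | l in K & c in [set: R]].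

Definition supp h H : set (X -> R) := [set u | H u /\ forall x, u x <= h x].

Definition sum_rule f1 L1 f2 L2 : Prop :=
  fset_add (supp f1 (const_shifts L1)) (supp f2 (const_shifts L2)) =
  supp (f1 + f2) (fset_add (const_shifts L1) (const_shifts L2)).

(* The sum rule for the subproblem with prox-center y, dual iterate lam and
   step size c. *)
Definition prox_sum_rule L f phi lam y (c : R) : Prop :=
  sum_rule f L
    (fun x => c^-1 * bregman phi lam x y) [set l - c^-1 *: lam | l in L].

(* An infinite run: primal iterates x_, dual iterates lam_ and subgradients g_
   (the value g_ 0 is never used). *)
Record infinite_prox_run L f phi (c : nat -> R)
    (x_ : nat -> X) (lam_ g_ : nat -> X -> R) : Prop := InfiniteProxRun {
  run_init : L_subdiff L phi (x_ 0%N) (lam_ 0%N);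
  run_argmin : forall k,
    argmin (fun x => f x + (c k)^-1 * bregman phi (lam_ k) x (x_ k))
      (x_ k.+1);
  run_subgrad : forall k, L_subdiff L f (x_ k.+1) (g_ k.+1);
  run_dual_update : forall k, lam_ k.+1 = lam_ k - c k *: g_ k.+1;
  run_dual_subgrad : forall k, L_subdiff L phi (x_ k.+1) (lam_ k.+1);
  run_no_stop : forall k, ~ L_subdiff L f (x_ k.+1) 0
}.

End AbstractConvexity.

(* Main.v *)
Require Import Defs.
From mathcomp Require Import all_boot all_order all_algebra.
From mathcomp Require Import all_classical all_reals all_analysis.
From mathcomp Require Import ring lra.

(** For every u, the three-point identity for Bregman divergences together with
    the subgradient inequality gives
      c_k (f(x_(k+1)) - f(u)) <= D_k(u) - D_(k+1)(u),
    where D_k(u) >= 0 is the divergence of u from x_k taken at lambda_k. As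
    f(x_k) is nonincreasing, summing yields
      (c_0 + ... + c_(n-1)) (f(x_n) - f(u)) <= D_0(u),
    and the step sizes have a divergent sum. *)

Set Implicit Arguments.
Unset Strict Implicit.
Unset Printing Implicit Defensive.

Import Order.TTheory GRing.Theory Num.Theory.
Import numFieldNormedType.Exports.

Local Open Scope classical_set_scope.
Local Open Scope ring_scope.

Section BregmanProximalPoint.
Context {R : realType} {X : normedModType R}.
Implicit Types (L : set (X -> R)) (f phi lam g : X -> R) (x y u : X).

Lemma bregman_ge0 L phi y lam u :
  L_subdiff L phi y lam -> 0 <= bregman phi lam u y.
Proof. by move=> [_ /(_ u)]; rewrite /bregman; lra. Qed.

Lemma bregmanxx phi lam x : bregman phi lam x x = 0.
Proof. by rewrite /bregman; ring. Qed.

(** The terms in [x] cancel on the right, so the centre [x] is free; the descent estimate takes the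
    previous iterate. *)
Lemma bregman_three_point phi lam (a : R) g x y u :
  bregman phi (lam - a *: g) u y =
  bregman phi lam u x - bregman phi lam y x + a * (g u - g y).
Proof.
have lamE z : (lam - a *: g) z = lam z - a * g z by [].
by rewrite /bregman !lamE; ring.
Qed.

Variables (L : set (X -> R)) (f phi : X -> R) (c : nat -> R).
Variables (x_ : nat -> X) (lam_ g_ : nat -> X -> R).
Hypothesis c_gt0 : forall k, 0 < c k.
Hypothesis run : infinite_prox_run L f phi c x_ lam_ g_.

Lemma prox_run_subdiff k : L_subdiff L phi (x_ k) (lam_ k).
Proof. by case: k => [|k]; [case: run | exact: run_dual_subgrad run k]. Qed.

(** In the subproblem, [x_ k] competes with the minimizer [x_ k.+1]: its divergence from itself
    vanishes, while that of [x_ k.+1] is nonnegative. *)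
Lemma prox_run_nonincreasing : nonincreasing_seq (f \o x_).
Proof.
apply/nonincreasing_seqP => k /=.
have := run_argmin run k (x_ k); rewrite bregmanxx mulr0 addr0.
apply: le_trans; rewrite lerDl mulr_ge0//; first by rewrite invr_ge0 ltW.
exact: bregman_ge0 _ (prox_run_subdiff k).
Qed.

Lemma prox_run_descent k u :
  c k * (f (x_ k.+1) - f u) <=
  bregman phi (lam_ k) u (x_ k) - bregman phi (lam_ k.+1) u (x_ k.+1).
Proof.
rewrite (run_dual_update run k) (bregman_three_point _ _ _ _ (x_ k)).
(* The divergence of [x_ k.+1] from [x_ k] left over by the three-point identity is nonnegative and
   gets dropped. *)
have D_ge0 := bregman_ge0 (x_ k.+1) (prox_run_subdiff k).
have [_ /(_ u) g_le] := run_subgrad run k.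
have : c k * (g_ k.+1 u - g_ k.+1 (x_ k.+1)) <= c k * (f u - f (x_ k.+1)).
  by rewrite ler_pM2l//; lra.
by lra.
Qed.

Lemma prox_run_rate n u :
  (\sum_(0 <= k < n) c k) * (f (x_ n) - f u) <=
  bregman phi (lam_ 0%N) u (x_ 0%N).
Proof.
rewrite mulr_suml.
apply: (@le_trans _ _ (\sum_(0 <= k < n) (bregman phi (lam_ k) u (x_ k) -
    bregman phi (lam_ k.+1) u (x_ k.+1)))).
  apply: ler_sum_nat => k /andP[_ kn].
  apply: le_trans (prox_run_descent k u).
  (* Here [k < n] is read as [k.+1 <= n], so monotonicity gives [f (x_ n) <= f (x_ k.+1)]. *)
  by rewrite ler_pM2l// lerD2r; exact: prox_run_nonincreasing.
(* Two sign changes turn the summands into successor minus current, the form that [telescope_sumr]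
   expects. *)
rewrite -[leLHS]opprK -sumrN.
under eq_bigr do rewrite opprB.
rewrite telescope_sumr// opprB gerBl.
exact: bregman_ge0 _ (prox_run_subdiff n).
Qed.

Hypothesis c_unbounded : forall M, exists n, M < \sum_(0 <= k < n) c k.

Lemma prox_run_approaches u (e : R) :
  0 < e -> exists n, f (x_ n) <= f u + e.
Proof.
move=> e_gt0.
(* With this threshold the step sizes before [n], times [e], exceed the initial divergence; a gap
   above [e] at [x_ n] would contradict the rate. *)
have [n] := c_unbounded (bregman phi (lam_ 0%N) u (x_ 0%N) / e).
rewrite ltr_pdivrMr// => D_lt; exists n; rewrite -lerBlDl.
have S_ge0 : 0 <= \sum_(0 <= k < n) c k by apply: sumr_ge0 => k _; exact: ltW.
rewrite leNgt; apply/negP => e_lt.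
have := ler_wpM2l S_ge0 (ltW e_lt).
by have := prox_run_rate n u; lra.
Qed.

(** Stated in the extended reals since [f] may be unbounded below. A nonincreasing sequence tends to
    the infimum of its values, so only two infima need comparing. *)
Lemma prox_run_cvg :
  (f (x_ l))%:E @[l --> \oo] --> ereal_inf [set (f x)%:E | x in [set: X]].
Proof.
suff -> : ereal_inf [set (f x)%:E | x in [set: X]] =
          ereal_inf (range (fun l => (f (x_ l))%:E)).
  by apply: ereal_nonincreasing_cvgn => m n mn;
     rewrite lee_fin; exact: prox_run_nonincreasing.
apply/eqP; rewrite eq_le; apply/andP; split.
  by apply: ereal_inf_le_tmp => _ [l _ <-]; exists (x_ l).
apply: le_ereal_inf_tmp => _ [u _ <-]; apply/lee_addgt0Pr => e e_gt0.
have [n fn_le] := prox_run_approaches u e_gt0.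
apply: (@le_trans _ _ (f (x_ n))%:E); last by rewrite -EFinD lee_fin.
by apply: ereal_inf_lbound; exists n.
Qed.

End BregmanProximalPoint.

Lemma nneseries_pinfty_unbounded (R : realType) (c : nat -> R) m :
  (forall k, 0 <= c k) -> (\sum_(m <= k <oo) (c k)%:E = +oo)%E ->
  forall M, exists n, M < \sum_(m <= k < n) c k.
Proof.
move=> c_ge0 cy M; apply: contrapT => /forallNP c_le.
suff : (\sum_(m <= k <oo) (c k)%:E <= M%:E)%E by rewrite cy.
apply: lime_le; first by apply: is_cvg_nneseries => k _ _; rewrite lee_fin.
apply: nearW => n; rewrite sumEFin lee_fin leNgt; apply/negP; exact: c_le.
Qed.

Theorem theorem3 (R : realType) (X : normedModType R) (L : set (X -> R))
    (f phi : X -> R) (c : nat -> R)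
    (L_nonempty : L !=set0)
    (f_convex : L_convex L f) (phi_convex : L_convex L phi)
    (c_gt0 : forall k, 0 < c k)
    (A1 : forall (y : X) (lam : X -> R), L_subdiff L phi y lam ->
       forall a : R, bounded_set [set x | bregman phi lam x y <= a])
    (A2 : (fset_sub L L `<=` L /\ (forall k, c k = 1)) \/
          (submod_closed (mem L) /\
           (\sum_(1 <= k <oo) (c k)%:E = +oo)%E))
    (x_ : nat -> X) (lam_ g_ : nat -> X -> R)
    (run : infinite_prox_run L f phi c x_ lam_ g_)
    (sum_rules : forall k, prox_sum_rule L f phi (lam_ k) (x_ k) (c k)) :
  (f (x_ l))%:E @[l --> \oo] --> ereal_inf [set (f x)%:E | x in [set: X]].
Proof.
apply: (prox_run_cvg c_gt0 run) => M.
case: A2 => [[_ c1]|[_ cy]].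
  (* With unit steps the partial sum up to [n] is [n] itself. *)
  exists (Num.bound `|M|); under eq_bigr do rewrite c1.
  rewrite sumr_const_nat subn0.
  exact: le_lt_trans (ler_norm M) (archi_boundP (normr_ge0 M)).
have c_ge0 k : 0 <= c k by exact: ltW.
have [n M_lt] := nneseries_pinfty_unbounded c_ge0 cy M.
exists n; apply: lt_le_trans M_lt _.
(* The series starts at index 1 and the rate at 0: the extra term [c 0] only enlarges the sum, and
   for [n = 0] both sums are empty. *)
by case: n => [|n]; [rewrite !big_geq | rewrite [leRHS]big_ltn// lerDr].
Qed.
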